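(* For $y_2,\,y_1-y_2\notin\mathbb Zv$ we have $$f_3(\boldsymbol z;\tau)=\left(\zeta_1^{-1}\zeta_2\right)^{3\left(\frac12+\lfloor\frac{y_2}{v}\rfloor\right)}A\left(3(z_1-z_2),\ 3z_1-3\left\lfloor\tfrac{y_2}{v}\right\rfloor\tau-\tfrac{3\tau}{2}+\tfrac12;\ 3\tau\right).$$
   Context: Notation: $\tau=u+iv\in\mathbb H$, $\boldsymbol z=\boldsymbol x+i\boldsymbol y\in\mathbb C^2$, $q:=e^{2\pi i\tau}$, $\zeta_j:=e^{2\pi i z_j}$, with rational powers $\zeta_j^s:=e^{2\pi i sz_j}$. $\operatorname{sgn}(x):=x/|x|$ for $x\neq0$, $\operatorname{sgn}(0):=0$; $H(x):=1$ for $x>0$, $H(x):=0$ for $x\le0$; $H^*(x):=1$ for $x\ge0$, $H^*(x):=0$ for $x<0$. With $\chi_3(\boldsymbol x):=\operatorname{sgn}(x_1)H(|x_1|-|x_2|)H^*(x_1x_2)$, the generating function for trapezoids is $$f_3(\boldsymbol z;\tau):=\sum_{\boldsymbol n\in\mathbb Z^2}\chi_3\left(\boldsymbol n+\tfrac{\boldsymbol y}{v}\right)q^{\frac32(n_1^2-n_2^2)}\zeta_1^{3n_1}\zeta_2^{-3n_2}.$$ The Appell function is $$A(z_1,z_2;\tau):=e^{\pi i z_1}\sum_{n\in\mathbb Z}\frac{(-1)^nq^{\frac{n(n+1)}{2}}e^{2\pi i nz_2}}{1-e^{2\pi i z_1}q^n}.$$ *)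

(* Defs.v *)
(* Stdlib reals, with Coquelicot's complex numbers and filters. *)
From Stdlib Require Import Reals Lra List Classical ClassicalEpsilon.
From Coquelicot Require Import Coquelicot.

Open Scope R_scope.

(* Unconditional summation over an arbitrary index type (here Z and Z * Z):
   the limit of the finite partial sums along the directed set of finite
   subsets, a finite subset being a duplicate-free list. *)
Definition finite_subsets {I : Type} (P : list I -> Prop) : Prop :=
  exists l0 : list I, forall l : list I, NoDup l -> incl l0 l -> P l.

Definition partial_sum {I : Type} (f : I -> C) (l : list I) : C :=
  fold_right Cplus (RtoC 0) (map f l).

Definition is_sum {I : Type} (f : I -> C) (s : C) : Prop :=
  filterlim (partial_sum f) finite_subsets (locally s).

Definition ex_sum {I : Type} (f : I -> C) : Prop := exists s : C, is_sum f s.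

Definition Csum {I : Type} (f : I -> C) : C :=
  iota (T := C_CompleteNormedModule) (is_sum f).

#[global] Instance finite_subsets_proper (I : Type) :
  ProperFilter (@finite_subsets I).
Proof.
split.
- intros P [l0 Hl0].
  exists (nodup (fun x y : I => excluded_middle_informative (x = y)) l0).
  apply Hl0.
  + apply NoDup_nodup.
  + intros x Hx; apply nodup_In; exact Hx.
- split.
  + exists nil; auto.
  + intros P Q [l1 H1] [l2 H2]; exists (l1 ++ l2); intros l Hl Hi.
    split; [apply H1 | apply H2]; auto;
      intros x Hx; apply Hi, in_or_app; auto.
  + intros P Q HPQ [l0 H0]; exists l0; auto.
Qed.

Lemma is_sum_unique {I : Type} (f : I -> C) (s : C) :
  is_sum f s -> Csum f = s.
Proof.
intros H; unfold Csum, is_sum.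
apply (iota_filterlim_locally (partial_sum f) s H).
Qed.

Definition Cexp (w : C) : C :=
  (exp (Re w) * cos (Im w), exp (Re w) * sin (Im w)).

(* e^(2 pi i s w), that is q^s for w = tau and zeta_j^s for w = z_j. *)
Definition epow (w : C) (s : R) : C := Cexp (2 * PI * Ci * s * w)%C.

Definition heaviside (x : R) : R := if Rlt_dec 0 x then 1 else 0.

Definition heaviside_star (x : R) : R := if Rle_dec 0 x then 1 else 0.

Definition chi3 (x1 x2 : R) : R :=
  sign x1 * heaviside (Rabs x1 - Rabs x2) * heaviside_star (x1 * x2).

Definition f3_term (z1 z2 tau : C) (n : Z * Z) : C :=
  let n1 := IZR (fst n) in
  let n2 := IZR (snd n) in
  (chi3 (n1 + Im z1 / Im tau) (n2 + Im z2 / Im tau)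
   * epow tau (3 / 2 * (n1 ^ 2 - n2 ^ 2)) * epow z1 (3 * n1)
   * epow z2 (- 3 * n2))%C.

Definition f3 (z1 z2 tau : C) : C := Csum (f3_term z1 z2 tau).

Definition appell_denom (z1 tau : C) (n : Z) : C :=
  (1 - epow z1 1 * epow tau (IZR n))%C.

Definition appell_term (z1 z2 tau : C) (n : Z) : C :=
  (powerRZ (-1) n * epow tau (IZR n * (IZR n + 1) / 2) * epow z2 (IZR n)
   / appell_denom z1 tau n)%C.

Definition appell (z1 z2 tau : C) : C :=
  (Cexp (PI * Ci * z1) * Csum (appell_term z1 z2 tau))%C.

(* The point avoids the poles and the series converges; needed to rule out the
   default values of Cinv and Csum. *)
Definition appell_defined (z1 z2 tau : C) : Prop :=
  (forall n : Z, appell_denom z1 tau n <> RtoC 0)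
  /\ ex_sum (appell_term z1 z2 tau).

(* Main.v *)
(** Put k = n1 - n2 and m = n2. On the k-th diagonal consecutive monomials have
    the constant ratio r_k = q^(3k) (zeta1/zeta2)^3, and the sign pattern chi_3
    keeps the half-line m >= - floor(y2/v) when |r_k| < 1 and minus the
    complementary half-line when |r_k| > 1. In both cases the sum over m is the
    monomial at m = - floor(y2/v) divided by 1 - r_k, which is a constant times
    the k-th term of the Appell series. The double series converges absolutely
    because x1^2 - x2^2 dominates |k| + |m| on the support of chi_3: neither x2
    nor x1 - x2 gets close to 0. *)

Require Import Defs.
From Stdlib Require Import Reals Lra Lia List Permutation.
From Stdlib Require Import Classical ClassicalEpsilon.
From Coquelicot Require Import Coquelicot.

(** * Unconditional sums: linearity, reindexing and summation by rows *)

Lemma partial_sum_cons {I : Type} (f : I -> C) (a : I) (l : list I) :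
  partial_sum f (a :: l) = (f a + partial_sum f l)%C.
Proof. reflexivity. Qed.

Lemma partial_sum_app {I : Type} (f : I -> C) (l1 l2 : list I) :
  partial_sum f (l1 ++ l2) = (partial_sum f l1 + partial_sum f l2)%C.
Proof.
  induction l1 as [|a l1 IH]; simpl app.
  - unfold partial_sum at 2; simpl; ring.
  - rewrite !partial_sum_cons, IH; ring.
Qed.

Lemma partial_sum_perm {I : Type} (f : I -> C) (l1 l2 : list I) :
  Permutation l1 l2 -> partial_sum f l1 = partial_sum f l2.
Proof.
  induction 1; rewrite ?partial_sum_cons; try congruence; ring.
Qed.

Lemma partial_sum_map {I J : Type} (f : I -> C) (phi : J -> I) (l : list J) :
  partial_sum f (map phi l) = partial_sum (fun j => f (phi j)) l.
Proof. unfold partial_sum; rewrite map_map; reflexivity. Qed.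

Lemma partial_sum_ext {I : Type} (f g : I -> C) (l : list I) :
  (forall i, In i l -> f i = g i) -> partial_sum f l = partial_sum g l.
Proof.
  intros H; unfold partial_sum; f_equal; apply map_ext_in, H.
Qed.

Lemma is_sum_Cmod {I : Type} (f : I -> C) (s : C) :
  is_sum f s <->
  forall eps : posreal, exists l0, forall l, NoDup l -> incl l0 l ->
    Cmod (partial_sum f l - s) < eps.
Proof.
  exact (filterlim_locally_ball_norm (U := C_NormedModule) (partial_sum f) s).
Qed.

Lemma is_sum_ext {I : Type} (f g : I -> C) (s : C) :
  (forall i, f i = g i) -> is_sum f s -> is_sum g s.
Proof.
  intros Hfg; apply filterlim_ext; intros l; apply partial_sum_ext; auto.
Qed.

Lemma is_sum_det {I : Type} (f : I -> C) (s t : C) :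
  is_sum f s -> is_sum f t -> s = t.
Proof.
  intros Hs Ht; rewrite <- (is_sum_unique f s Hs); apply is_sum_unique, Ht.
Qed.

Lemma is_sum_plus {I : Type} (f g : I -> C) (s t : C) :
  is_sum f s -> is_sum g t -> is_sum (fun i => f i + g i)%C (s + t)%C.
Proof.
  intros Hf Hg.
  apply filterlim_ext with (fun l => plus (partial_sum f l) (partial_sum g l)).
  - intros l; induction l as [|a l IH].
    + change (0 + 0 = 0)%C; ring.
    + rewrite !partial_sum_cons, <- IH.
      change (f a + partial_sum f l + (g a + partial_sum g l)
              = f a + g a + (partial_sum f l + partial_sum g l))%C; ring.
  - exact (filterlim_comp_2 _ _ _ Hf Hg
             (filterlim_plus (V := C_NormedModule) s t)).
Qed.

Lemma is_sum_scal {I : Type} (c : C) (f : I -> C) (s : C) :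
  is_sum f s -> is_sum (fun i => c * f i)%C (c * s)%C.
Proof.
  intros Hf.
  apply filterlim_ext with (fun l => scal c (partial_sum f l)).
  - intros l; induction l as [|a l IH].
    + change (c * 0 = 0)%C; ring.
    + rewrite !partial_sum_cons, <- IH.
      change (c * (f a + partial_sum f l)
              = c * f a + c * partial_sum f l)%C; ring.
  - exact (filterlim_comp _ _ _ _ _ _ _ _ Hf
             (filterlim_scal_r (V := C_NormedModule) c s)).
Qed.

Lemma is_sum_reindex {I J : Type} (phi : J -> I) (psi : I -> J)
  (f : I -> C) (s : C) :
  (forall j, psi (phi j) = j) -> (forall i, phi (psi i) = i) ->
  is_sum f s -> is_sum (fun j => f (phi j)) s.
Proof.
  intros Hl Hr Hf; apply is_sum_Cmod; intros eps.
  destruct (proj1 (is_sum_Cmod f s) Hf eps) as [l0 H0].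
  exists (map psi l0); intros l Hnd Hi.
  rewrite <- partial_sum_map; apply H0.
  - apply FinFun.Injective_map_NoDup; auto.
    intros x y E; rewrite <- (Hl x), E; apply Hl.
  - intros i Hin; rewrite <- (Hr i); apply in_map, Hi, in_map, Hin.
Qed.

Lemma is_sum_single {I : Type} (f : I -> C) (i0 : I) :
  (forall i, i <> i0 -> f i = 0%C) -> is_sum f (f i0).
Proof.
  intros Hf; apply is_sum_Cmod; intros eps.
  exists (i0 :: nil); intros l Hnd Hi.
  destruct (in_split i0 l (Hi i0 (or_introl eq_refl))) as [l1 [l2 ->]].
  apply NoDup_remove_2 in Hnd.
  rewrite <- (partial_sum_perm f (i0 :: l1 ++ l2) _ (Permutation_middle _ _ _)),
    partial_sum_cons, (partial_sum_ext f (fun _ => 0%C) (l1 ++ l2)).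
  - replace (partial_sum (fun _ : I => 0%C) (l1 ++ l2)) with (RtoC 0).
    + replace (f i0 + 0 - f i0)%C with (RtoC 0) by ring.
      rewrite Cmod_0; apply cond_pos.
    + clear; induction (l1 ++ l2) as [|a l IH]; [reflexivity|].
      rewrite partial_sum_cons, <- IH; ring.
  - intros i Hin; apply Hf; intros ->; contradiction.
Qed.

(** Equality on an arbitrary index type is decided classically, so any finite list can be made
    duplicate-free. *)
Definition dedup {I : Type} : list I -> list I :=
  nodup (fun x y : I => excluded_middle_informative (x = y)).

(** Summation by rows. For finitely many rows [K], the row sums are approximated by a finite set of
    pairs lying over [K]; once [K] contains the rows of [l0], this set can be chosen to contain
    [l0], so its partial sum is close to [s]. *)
Lemma is_sum_sections {I J : Type} (F : I * J -> C) (G : I -> C) (s : C) :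
  is_sum F s -> (forall i, is_sum (fun j => F (i, j)) (G i)) -> is_sum G s.
Proof.
  intros HF HG.
  (* Induction on the rows: each new row is allowed half of the remaining error. *)
  assert (approx : forall l0 K, NoDup K -> forall eps, 0 < eps ->
    exists l, NoDup l /\ (forall p, In p l -> In (fst p) K)
      /\ (forall p, In p l0 -> In (fst p) K -> In p l)
      /\ Cmod (partial_sum F l - partial_sum G K) < eps).
  { intros l0 K; induction K as [|k K IH]; intros HK eps Heps.
    - exists nil; repeat split; try constructor; simpl; try tauto.
      unfold partial_sum; simpl.
      replace (0 - 0)%C with (RtoC 0) by ring; rewrite Cmod_0; exact Heps.
    - inversion HK as [|? ? Hk HK']; subst.
      destruct (IH HK' (eps / 2)) as [l [Hl [HlK [Hl0 Hle]]]]; [lra|].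
      destruct (proj1 (is_sum_Cmod _ _) (HG k) (mkposreal (eps / 2) ltac:(lra)))
        as [l1 H1]; simpl in H1.
      (* [l1] makes the row sum accurate; the columns of [l0] are added so that no pair of [l0] in
         row [k] is missed. *)
      set (L := dedup (l1 ++ map snd l0)).
      assert (HL : forall j, In j L <-> In j (l1 ++ map snd l0))
        by (intros j; apply nodup_In).
      exists (map (pair k) L ++ l); repeat split.
      + apply NoDup_app; auto.
        * apply FinFun.Injective_map_NoDup; [congruence | apply NoDup_nodup].
        * intros p Hp Hp'; apply in_map_iff in Hp as [j [<- _]].
          exact (Hk (HlK _ Hp')).
      + intros p Hp; apply in_app_or in Hp as [Hp|Hp].
        * apply in_map_iff in Hp as [j [<- _]]; left; reflexivity.
        * right; apply HlK, Hp.
      + intros [i j] Hp [Hi|Hi]; apply in_or_app; simpl in Hi.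
        * subst; left; apply in_map, HL, in_or_app; right.
          apply (in_map snd _ _ Hp).
        * right; apply Hl0; auto.
      + rewrite partial_sum_app, partial_sum_map, partial_sum_cons.
        replace (partial_sum (fun j => F (k, j)) L + partial_sum F l
                 - (G k + partial_sum G K))%C
          with ((partial_sum (fun j => F (k, j)) L - G k)
                + (partial_sum F l - partial_sum G K))%C by ring.
        eapply Rle_lt_trans; [apply Cmod_triangle|].
        assert (Cmod (partial_sum (fun j => F (k, j)) L - G k) < eps / 2); [|lra].
        apply H1; [apply NoDup_nodup|].
        intros j Hj; apply HL, in_or_app; auto. }
  apply is_sum_Cmod; intros eps.
  pose proof (cond_pos eps) as Heps.
  destruct (proj1 (is_sum_Cmod F s) HF (mkposreal (eps / 2) ltac:(lra)))
    as [l0 H0]; simpl in H0.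
  exists (map fst l0); intros K HK Hincl.
  destruct (approx l0 K HK (eps / 2)) as [l [Hl [_ [Hl0 Hle]]]]; [lra|].
  replace (partial_sum G K - s)%C
    with (- (partial_sum F l - partial_sum G K) + (partial_sum F l - s))%C by ring.
  eapply Rle_lt_trans; [apply Cmod_triangle|]; rewrite Cmod_opp.
  assert (Cmod (partial_sum F l - s) < eps / 2); [|lra].
  apply H0; auto.
  intros p Hp; apply Hl0, Hincl, in_map; exact Hp.
Qed.

(** * Absolute convergence by domination *)

Definition Rsum {I : Type} (g : I -> R) (l : list I) : R :=
  fold_right Rplus 0 (map g l).

(** For a nonnegative family this is summability, stated without a limit. *)
Definition bounded_sums {I : Type} (g : I -> R) : Prop :=
  exists B, forall l, NoDup l -> Rsum g l <= B.

Lemma Rsum_app {I : Type} (g : I -> R) (l1 l2 : list I) :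
  Rsum g (l1 ++ l2) = Rsum g l1 + Rsum g l2.
Proof.
  unfold Rsum; induction l1 as [|a l1 IH]; simpl; lra.
Qed.

Lemma Rsum_perm {I : Type} (g : I -> R) (l1 l2 : list I) :
  Permutation l1 l2 -> Rsum g l1 = Rsum g l2.
Proof. unfold Rsum; induction 1; simpl; lra. Qed.

Lemma Rsum_scal {I : Type} (c : R) (g : I -> R) (l : list I) :
  Rsum (fun i => c * g i) l = c * Rsum g l.
Proof.
  unfold Rsum; induction l as [|a l IH]; simpl; [|rewrite IH]; ring.
Qed.

Lemma Rsum_nonneg {I : Type} (g : I -> R) (l : list I) :
  (forall i, 0 <= g i) -> 0 <= Rsum g l.
Proof.
  intros Hg; unfold Rsum; induction l as [|a l IH]; simpl; [lra|].
  specialize (Hg a); lra.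
Qed.

Lemma NoDup_incl_Permutation {I : Type} (l l' : list I) :
  NoDup l -> incl l l' -> exists r, Permutation l' (l ++ r).
Proof.
  revert l'; induction l as [|a l IH]; intros l' Hnd Hi.
  - exists l'; reflexivity.
  - inversion Hnd as [|? ? Ha Hl]; subst.
    destruct (in_split a l' (Hi a (or_introl eq_refl))) as [l1 [l2 ->]].
    destruct (IH (l1 ++ l2) Hl) as [r Hr].
    + intros x Hx; specialize (Hi x (or_intror Hx)).
      apply in_app_or in Hi as [?|[->|?]]; [| contradiction |];
        apply in_or_app; auto.
    + exists r; rewrite <- Permutation_middle; simpl.
      apply perm_skip, Hr.
Qed.

Lemma Rsum_incl {I : Type} (g : I -> R) (l l' : list I) :
  (forall i, 0 <= g i) -> NoDup l -> incl l l' -> Rsum g l <= Rsum g l'.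
Proof.
  intros Hg Hnd Hi; destruct (NoDup_incl_Permutation l l' Hnd Hi) as [r Hr].
  rewrite (Rsum_perm g _ _ Hr), Rsum_app.
  pose proof (Rsum_nonneg g r Hg); lra.
Qed.

Lemma Cmod_partial_sum_le {I : Type} (f : I -> C) (g : I -> R) (l : list I) :
  (forall i, Cmod (f i) <= g i) -> Cmod (partial_sum f l) <= Rsum g l.
Proof.
  intros Hfg; induction l as [|a l IH].
  - unfold partial_sum, Rsum; simpl; rewrite Cmod_0; lra.
  - rewrite partial_sum_cons; eapply Rle_trans; [apply Cmod_triangle|].
    apply Rplus_le_compat; auto.
Qed.

(** Completeness of the complex numbers reduces the claim to a Cauchy condition. If the sum of [g]
    over [l0] is within eps/2 of the supremum [S], enlarging [l0] changes the partial sum of [f] by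
    less than eps/2. *)
Lemma ex_sum_dominated {I : Type} (f : I -> C) (g : I -> R) :
  (forall i, Cmod (f i) <= g i) -> bounded_sums g -> ex_sum f.
Proof.
  intros Hfg [B HB].
  destruct (completeness (fun x => exists l, NoDup l /\ x = Rsum g l))
    as [S [HS1 HS2]].
  { exists B; intros x [l [Hl ->]]; auto. }
  { exists (Rsum g nil), nil; split; [constructor | reflexivity]. }
  apply (filterlim_locally_cauchy (U := C_CompleteNormedModule)); intros eps.
  pose proof (cond_pos eps) as Heps.
  destruct (classic (exists l0, NoDup l0 /\ S - eps / 2 < Rsum g l0))
    as [[l0 [Hl0 HS0]]|Hno].
  2: { exfalso; assert (S <= S - eps / 2); [|lra].
       apply HS2; intros x [l [Hl ->]].
       destruct (Rle_lt_dec (Rsum g l) (S - eps / 2)); auto.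
       exfalso; eauto. }
  exists (fun l => NoDup l /\ incl l0 l); split.
  { exists l0; auto. }
  assert (near : forall l, NoDup l -> incl l0 l ->
    Cmod (partial_sum f l - partial_sum f l0) < eps / 2).
  { intros l Hl Hi.
    destruct (NoDup_incl_Permutation l0 l Hl0 Hi) as [r Hr].
    rewrite (partial_sum_perm f _ _ Hr), partial_sum_app.
    replace (partial_sum f l0 + partial_sum f r - partial_sum f l0)%C
      with (partial_sum f r) by ring.
    eapply Rle_lt_trans; [apply (Cmod_partial_sum_le f g), Hfg|].
    assert (Rsum g l <= S) by (apply HS1; eauto).
    rewrite (Rsum_perm g _ _ Hr), Rsum_app in H; lra. }
  intros u v [Hu Hu'] [Hv Hv'].
  apply (norm_compat1 (V := C_NormedModule)).
  change (Cmod (partial_sum f v - partial_sum f u) < eps).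
  replace (partial_sum f v - partial_sum f u)%C
    with ((partial_sum f v - partial_sum f l0)
          + - (partial_sum f u - partial_sum f l0))%C by ring.
  eapply Rle_lt_trans; [apply Cmod_triangle|]; rewrite Cmod_opp.
  pose proof (near u Hu Hu'); pose proof (near v Hv Hv'); lra.
Qed.

Lemma bounded_sums_scal {I : Type} (c : R) (g : I -> R) :
  0 <= c -> bounded_sums g -> bounded_sums (fun i => c * g i).
Proof.
  intros Hc [B HB]; exists (c * B); intros l Hl.
  rewrite Rsum_scal; apply Rmult_le_compat_l; auto.
Qed.

(** A finite set of pairs lies in the rectangle of its two projections, over which the double sum
    factors. *)
Lemma bounded_sums_prod {I J : Type} (g : I -> R) (h : J -> R) :
  (forall i, 0 <= g i) -> (forall j, 0 <= h j) ->
  bounded_sums g -> bounded_sums h ->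
  bounded_sums (fun p : I * J => g (fst p) * h (snd p)).
Proof.
  intros Hg Hh [A HA] [B HB]; exists (A * B); intros l Hl.
  set (K := dedup (map fst l)); set (L := dedup (map snd l)).
  apply Rle_trans with
    (Rsum (fun p : I * J => g (fst p) * h (snd p)) (list_prod K L)).
  - apply Rsum_incl; auto.
    + intros p; apply Rmult_le_pos; auto.
    + intros [i j] Hp; apply in_prod; apply nodup_In;
        [apply (in_map fst _ _ Hp) | apply (in_map snd _ _ Hp)].
  - replace (Rsum (fun p : I * J => g (fst p) * h (snd p)) (list_prod K L))
      with (Rsum g K * Rsum h L).
    + apply Rmult_le_compat; try apply Rsum_nonneg; auto;
        [apply HA | apply HB]; apply NoDup_nodup.
    + generalize K; clear; intros K; induction K as [|k K IH].
      * unfold Rsum; simpl; ring.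
      * change (list_prod (k :: K) L) with (map (pair k) L ++ list_prod K L).
        rewrite Rsum_app, <- IH.
        replace (Rsum (fun p : I * J => g (fst p) * h (snd p)) (map (pair k) L))
          with (g k * Rsum h L); [change (Rsum g (k :: K)) with (g k + Rsum g K); ring|].
        rewrite <- Rsum_scal; unfold Rsum; rewrite map_map; reflexivity.
Qed.

Lemma bounded_sums_exp_abs (a : R) :
  0 < a -> bounded_sums (fun k : Z => exp (- a * Rabs (IZR k))).
Proof.
  intros Ha; set (g := fun k : Z => exp (- a * Rabs (IZR k))).
  set (r := exp (- a)).
  assert (Hr : 0 < r < 1).
  { split; [apply exp_pos|]; unfold r; rewrite <- exp_0.
    apply exp_increasing; lra. }
  (* [box n] enumerates the integers of [-n, n]; these intervals exhaust the integers. *)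
  set (box := fix box (n : nat) : list Z :=
    match n with
    | O => 0%Z :: nil
    | S m => Z.of_nat n :: (- Z.of_nat n)%Z :: box m
    end).
  assert (Hbox : forall n k, (Z.abs k <= Z.of_nat n)%Z -> In k (box n)).
  { induction n as [|n IH]; intros k Hk.
    - left; lia.
    - destruct (Z.eq_dec k (Z.of_nat (S n))) as [->|]; [left; reflexivity|].
      destruct (Z.eq_dec k (- Z.of_nat (S n))) as [->|]; [right; left; reflexivity|].
      right; right; apply IH; lia. }
  (* The closed form of 1 + 2(r + ... + r^n), with r^n written as exp(-a n). *)
  assert (Hsum : forall n, Rsum g (box n)
    = (1 + r - 2 * r * exp (- a * INR n)) / (1 - r)).
  { induction n as [|n IH].
    - unfold Rsum, g; simpl; rewrite Rabs_R0, Rmult_0_r, exp_0; field; lra.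
    - change (Rsum g (box (S n)))
        with (g (Z.of_nat (S n)) + (g (- Z.of_nat (S n))%Z + Rsum g (box n))).
      rewrite IH; unfold g; rewrite opp_IZR, Rabs_Ropp, <- INR_IZR_INZ.
      rewrite (Rabs_pos_eq (INR (S n))) by apply pos_INR.
      rewrite S_INR, Rmult_plus_distr_l, exp_plus, Rmult_1_r; fold r.
      field; lra. }
  exists ((1 + r) / (1 - r)); intros l Hl.
  assert (Hn : exists n, incl l (box n)).
  { clear Hl; assert (exists n, forall k, In k l -> (Z.abs k <= Z.of_nat n)%Z)
      as [n Hn].
    - induction l as [|k l [n Hn]]; [exists O; simpl; tauto|].
      exists (Nat.max (Z.abs_nat k) n); intros k' [<-|Hk']; [lia|].
      specialize (Hn k' Hk'); lia.
    - exists n; intros k Hk; apply Hbox, Hn, Hk. }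
  destruct Hn as [n Hn].
  apply Rle_trans with (Rsum g (box n)).
  - apply Rsum_incl; auto; intros k; left; apply exp_pos.
  - rewrite Hsum; apply Rmult_le_compat_r.
    + left; apply Rinv_0_lt_compat; lra.
    + assert (0 < r * exp (- a * INR n)); [|lra].
      apply Rmult_lt_0_compat; [lra | apply exp_pos].
Qed.

(** * The complex exponential *)

Lemma Cexp_plus (w w' : C) : Cexp (w + w') = (Cexp w * Cexp w')%C.
Proof.
  unfold Cexp, Re, Im; apply injective_projections; simpl;
    rewrite exp_plus, ?cos_plus, ?sin_plus; ring.
Qed.

Lemma Cmod_Cexp (w : C) : Cmod (Cexp w) = exp (Re w).
Proof.
  unfold Cmod, Cexp; simpl fst; simpl snd.
  replace ((exp (Re w) * cos (Im w)) ^ 2 + (exp (Re w) * sin (Im w)) ^ 2)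
    with (Rsqr (exp (Re w)) * (Rsqr (sin (Im w)) + Rsqr (cos (Im w))))
    by (unfold Rsqr; ring).
  rewrite sin2_cos2, Rmult_1_r; apply sqrt_Rsqr; left; apply exp_pos.
Qed.

Lemma Cexp_neq_0 (w : C) : Cexp w <> 0%C.
Proof.
  apply Cmod_gt_0; rewrite Cmod_Cexp; apply exp_pos.
Qed.

Lemma Cmod_epow (w : C) (s : R) : Cmod (epow w s) = exp (- 2 * PI * s * Im w).
Proof.
  unfold epow; rewrite Cmod_Cexp; f_equal; unfold Re, Im; simpl; ring.
Qed.

Lemma powerRZ_m1_Cexp (n : Z) : RtoC (powerRZ (-1) n) = Cexp (PI * Ci * IZR n).
Proof.
  assert (Hpi : Cexp (PI * Ci) = RtoC (-1)).
  { unfold Cexp, Re, Im; simpl.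
    replace (PI * 0 - 0 * 1) with 0 by ring.
    replace (PI * 1 + 0 * 0) with PI by ring.
    rewrite exp_0, cos_PI, sin_PI; unfold RtoC; f_equal; ring. }
  (* An equivalence, because induction over the integers also runs downwards. *)
  assert (step : forall n, RtoC (powerRZ (-1) n) = Cexp (PI * Ci * IZR n)
    <-> RtoC (powerRZ (-1) (Z.succ n)) = Cexp (PI * Ci * IZR (Z.succ n))).
  { intros m; unfold Z.succ; rewrite powerRZ_add, plus_IZR by lra.
    rewrite powerRZ_1, RtoC_mult, RtoC_plus.
    replace (PI * Ci * (IZR m + 1))%C with (PI * Ci * IZR m + PI * Ci)%C by ring.
    rewrite Cexp_plus, Hpi; split; intros H; [now rewrite H|].
    rewrite <- (Cmult_1_r (powerRZ (-1) m)), <- (Cmult_1_r (Cexp _)).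
    replace (RtoC 1) with (-1 * -1)%C
      by (rewrite <- RtoC_mult; f_equal; ring).
    rewrite !Cmult_assoc, H; reflexivity. }
  induction n using Z.peano_ind.
  - replace (PI * Ci * 0)%C with (RtoC 0) by ring.
    unfold Cexp, Re, Im; simpl; rewrite exp_0, cos_0, sin_0.
    unfold RtoC; f_equal; ring.
  - apply (proj1 (step n)), IHn.
  - apply (proj2 (step (Z.pred n))); rewrite Z.succ_pred; exact IHn.
Qed.

(** * The sign pattern chi_3 along diagonals *)

(** For x2 > 0 the factor H^*(x1 x2) excludes x1 < 0; then |x1| - |x2| = x1 - x2, and sgn(x1) = 1
    wherever this is positive. *)
Lemma chi3_pos (x1 x2 : R) : 0 < x2 -> chi3 x1 x2 = heaviside (x1 - x2).
Proof.
  intros H2; unfold chi3, heaviside, heaviside_star.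
  rewrite (Rabs_pos_eq x2) by lra.
  destruct (Rlt_dec 0 (x1 - x2)).
  - rewrite sign_eq_1, Rabs_pos_eq by lra.
    destruct (Rlt_dec 0 (x1 - x2)); [|lra].
    destruct (Rle_dec 0 (x1 * x2)) as [|H]; [ring|].
    exfalso; apply H; nra.
  - destruct (Rle_dec 0 (x1 * x2)); [|ring].
    assert (0 <= x1) by nra.
    rewrite (Rabs_pos_eq x1) by lra.
    destruct (Rlt_dec 0 (x1 - x2)); [lra | ring].
Qed.

Lemma chi3_opp (x1 x2 : R) : chi3 (- x1) (- x2) = - chi3 x1 x2.
Proof.
  unfold chi3; rewrite !Rabs_Ropp, sign_opp, Rmult_opp_opp; ring.
Qed.

Lemma chi3_neg (x1 x2 : R) : x2 < 0 -> chi3 x1 x2 = - heaviside (x2 - x1).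
Proof.
  intros H2; rewrite <- (Ropp_involutive x1), <- (Ropp_involutive x2) at 1.
  rewrite chi3_opp, chi3_pos by lra; do 2 f_equal; ring.
Qed.

(* Crossing [x2 = 0] along the diagonal passes from the negative to the
   positive trapezoid, whichever of the two the line meets. *)
Lemma chi3_diagonal_jump (x1 x2 : R) :
  x1 <> x2 -> x2 < 0 < x2 + 1 -> chi3 (x1 + 1) (x2 + 1) - chi3 x1 x2 = 1.
Proof.
  intros H12 H2; rewrite chi3_pos, chi3_neg by lra; unfold heaviside.
  destruct (Rlt_dec 0 (x1 + 1 - (x2 + 1))), (Rlt_dec 0 (x2 - x1)); lra.
Qed.

(** On either side of x2 = 0 the value depends only on x1 - x2, which a diagonal step preserves. *)
Lemma chi3_diagonal_const (x1 x2 : R) :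
  0 < x2 \/ x2 + 1 < 0 -> chi3 (x1 + 1) (x2 + 1) = chi3 x1 x2.
Proof.
  intros [H|H]; [rewrite !chi3_pos by lra; f_equal; ring|].
  rewrite !chi3_neg by lra; do 2 f_equal; ring.
Qed.

(** On the support x1 - x2 and x2 have the same sign, so x1^2 - x2^2 = |x1 - x2| (|x1 - x2| +
    2|x2|), and the first factor is at least d. This makes the indefinite form coercive there. *)
Lemma chi3_bound (x1 x2 d : R) :
  x2 <> 0 -> d <= Rabs (x1 - x2) -> d <= Rabs x2 ->
  chi3 x1 x2 = 0 \/ Rabs (chi3 x1 x2) = 1
    /\ d * (Rabs (x1 - x2) + Rabs x2) <= x1 ^ 2 - x2 ^ 2.
Proof.
  intros H2 Hd1 Hd2; destruct (Rdichotomy _ _ H2) as [Hlt|Hgt].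
  - rewrite chi3_neg by lra; unfold heaviside.
    destruct (Rlt_dec 0 (x2 - x1)); [right | left; lra].
    rewrite Rabs_Ropp, Rabs_R1; rewrite !Rabs_left in * by lra; split; nra.
  - rewrite chi3_pos by lra; unfold heaviside.
    destruct (Rlt_dec 0 (x1 - x2)); [right | left; lra].
    rewrite Rabs_R1; rewrite !Rabs_pos_eq in * by lra; split; nra.
Qed.

(** * Monomials of f_3: diagonal step, edge value and modulus *)

Definition monomial (z1 z2 tau : C) (n1 n2 : R) : C :=
  (epow tau (3 / 2 * (n1 ^ 2 - n2 ^ 2)) * epow z1 (3 * n1)
   * epow z2 (- 3 * n2))%C.

(** A diagonal step raises n1^2 - n2^2 by 2(n1 - n2), so the ratio of consecutive monomials depends
    on n1 - n2 alone. *)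
Lemma monomial_diagonal_step (z1 z2 tau : C) (n1 n2 : R) :
  monomial z1 z2 tau (n1 + 1) (n2 + 1)
  = (epow (3 * (z1 - z2)) 1 * epow (3 * tau) (n1 - n2)
     * monomial z1 z2 tau n1 n2)%C.
Proof.
  unfold monomial, epow; rewrite <- !Cexp_plus; f_equal.
  apply injective_projections; simpl; field.
Qed.

(** The exponent of q is 3/2 (k^2 - 2kN) = 3k(k+1)/2 - 3k/2 - 3kN. The part linear in k goes into
    the second Appell argument, whose summand 1/2 cancels the sign (-1)^k. *)
Lemma monomial_edge (z1 z2 tau : C) (N : R) (k : Z) :
  let s := 3 * (1 / 2 + N) in
  monomial z1 z2 tau (IZR k - N) (- N)
  = (epow z1 (- s) * epow z2 s * Cexp (PI * Ci * (3 * (z1 - z2)))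
     * (powerRZ (-1) k * epow (3 * tau) (IZR k * (IZR k + 1) / 2)
        * epow (3 * z1 - 3 * N * tau - 3 * tau / 2 + 1 / 2) (IZR k)))%C.
Proof.
  intros s; rewrite powerRZ_m1_Cexp.
  (* The sign is squared away: [w2] contributes a second factor (-1)^k. *)
  assert (Hsq : (Cexp (PI * Ci * IZR k) * Cexp (PI * Ci * IZR k) = 1)%C).
  { rewrite <- powerRZ_m1_Cexp, <- RtoC_mult, <- powerRZ_mult.
    replace (-1 * -1) with 1 by ring; rewrite powerRZ_R1; reflexivity. }
  replace (epow (3 * z1 - 3 * N * tau - 3 * tau / 2 + 1 / 2) (IZR k))
    with (epow (3 * z1 - 3 * N * tau - 3 * tau / 2) (IZR k)
          * Cexp (PI * Ci * IZR k))%C.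
  2: { unfold epow; rewrite <- Cexp_plus; f_equal.
       apply injective_projections; simpl; field. }
  match goal with |- _ = (?a * (?e * ?b * (?c * ?e)))%C =>
    transitivity (a * b * c * (e * e))%C; [|ring] end.
  rewrite Hsq, Cmult_1_r.
  unfold monomial, epow; rewrite <- !Cexp_plus; f_equal.
  unfold s; apply injective_projections; simpl; field.
Qed.

(** Completing the squares produces the shift by [a] and [b] that also occurs inside chi_3; the
    remaining factor is independent of n1 and n2. *)
Lemma Cmod_monomial (z1 z2 tau : C) (n1 n2 : R) :
  Im tau <> 0 ->
  let a := Im z1 / Im tau in
  let b := Im z2 / Im tau in
  Cmod (monomial z1 z2 tau n1 n2)
  = exp (3 * PI * Im tau * (a ^ 2 - b ^ 2))
    * exp (- 3 * PI * Im tau * ((n1 + a) ^ 2 - (n2 + b) ^ 2)).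
Proof.
  intros Hv a b; unfold monomial; rewrite !Cmod_mult, !Cmod_epow, <- !exp_plus.
  f_equal; unfold a, b; field; exact Hv.
Qed.

Lemma dist_Z_pos (c : R) :
  (forall m : Z, c <> IZR m) -> exists d, 0 < d /\ forall k, d <= Rabs (IZR k + c).
Proof.
  intros Hc; pose proof (Zfloor_bound c) as [H1 H2].
  assert (H1' : IZR (Zfloor c) <> c) by (intros E; exact (Hc _ (eq_sym E))).
  (* The distance from [c] to the nearer of its two neighbouring integers. *)
  exists (Rmin (c - IZR (Zfloor c)) (IZR (Zfloor c) + 1 - c)); split.
  - apply Rmin_glb_lt; lra.
  - intros k; destruct (Z.le_gt_cases (- Zfloor c) k) as [Hk|Hk].
    + apply IZR_le in Hk; rewrite opp_IZR in Hk.
      eapply Rle_trans; [apply Rmin_l|]; rewrite Rabs_pos_eq; lra.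
    + assert (Hk' : (k <= - Zfloor c - 1)%Z) by lia.
      apply IZR_le in Hk'; rewrite minus_IZR, opp_IZR in Hk'.
      eapply Rle_trans; [apply Rmin_r|]; rewrite Rabs_left; lra.
Qed.

(** * Convergence of the double series and summation of each diagonal *)

Section Trapezoids.

Variables z1 z2 tau : C.
Hypothesis htau : 0 < Im tau.
Hypothesis hy2 : forall m : Z, Im z2 <> IZR m * Im tau.
Hypothesis hy12 : forall m : Z, Im z1 - Im z2 <> IZR m * Im tau.

Let a := Im z1 / Im tau.
Let b := Im z2 / Im tau.
Let N := Zfloor b.

Definition diagonal_term (p : Z * Z) : C :=
  f3_term z1 z2 tau (fst p + snd p, snd p)%Z.

(** The common ratio r_k on the k-th diagonal; 1 - r_k is also the k-th Appell denominator. *)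
Definition ratio (k : Z) : C :=
  (epow (3 * (z1 - z2)) 1 * epow (3 * tau) (IZR k))%C.

Lemma diagonal_termE (k m : Z) :
  diagonal_term (k, m)
  = (chi3 (IZR k + IZR m + a) (IZR m + b)
     * monomial z1 z2 tau (IZR k + IZR m) (IZR m))%C.
Proof.
  unfold diagonal_term, f3_term, monomial; simpl fst; simpl snd.
  rewrite plus_IZR; unfold a, b; ring.
Qed.

Lemma b_not_Z (m : Z) : b <> IZR m.
Proof.
  intros E; apply (hy2 m); rewrite <- E; unfold b; field; lra.
Qed.

Lemma a_minus_b_not_Z (m : Z) : a - b <> IZR m.
Proof.
  intros E; apply (hy12 m); rewrite <- E; unfold a, b; field; lra.
Qed.

Lemma diagonal_term_dominated :
  exists K r, 0 < r /\ forall p, Cmod (diagonal_term p)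
    <= exp K * (exp (- r * Rabs (IZR (fst p))) * exp (- r * Rabs (IZR (snd p)))).
Proof.
  destruct (dist_Z_pos _ a_minus_b_not_Z) as [d1 [Hd1 H1]].
  destruct (dist_Z_pos _ b_not_Z) as [d2 [Hd2 H2]].
  set (d := Rmin d1 d2).
  assert (Hd : 0 < d) by (apply Rmin_glb_lt; assumption).
  set (q := 3 * PI * Im tau).
  assert (Hq : 0 < q)
    by (pose proof PI_RGT_0; apply Rmult_lt_0_compat; lra).
  (* The term a^2 - b^2 comes from the modulus of the monomial; the multiple of d is the cost of
     replacing |k + a - b| and |m + b| by |k| and |m| through the triangle inequality. *)
  exists (q * (a ^ 2 - b ^ 2 + d * (Rabs (a - b) + Rabs b))), (q * d); split.
  { apply Rmult_lt_0_compat; assumption. }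
  intros [k m]; simpl fst; simpl snd.
  rewrite diagonal_termE, Cmod_mult, Cmod_R, Cmod_monomial by lra.
  fold a b; rewrite <- !exp_plus.
  replace (-3 * PI * Im tau) with (- q) by (unfold q; ring); fold q.
  destruct (chi3_bound (IZR k + IZR m + a) (IZR m + b) d) as [E|[E Hle]].
  - specialize (H2 m); intros E; rewrite E, Rabs_R0 in H2; lra.
  - replace (IZR k + IZR m + a - (IZR m + b)) with (IZR k + (a - b)) by ring.
    eapply Rle_trans; [apply Rmin_l | apply H1].
  - eapply Rle_trans; [apply Rmin_r | apply H2].
  - rewrite E, Rabs_R0, Rmult_0_l; left; apply exp_pos.
  - rewrite E, Rmult_1_l.
    assert (exp_le : forall x y, x <= y -> exp x <= exp y).
    { intros x y [Hxy| ->]; [left; apply exp_increasing, Hxy | right; reflexivity]. }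
    apply exp_le.
    replace (IZR k + IZR m + a - (IZR m + b)) with (IZR k + (a - b)) in Hle by ring.
    assert (Hk : Rabs (IZR k) <= Rabs (IZR k + (a - b)) + Rabs (a - b)).
    { rewrite <- (Rabs_Ropp (a - b)); eapply Rle_trans; [|apply Rabs_triang].
      right; f_equal; ring. }
    assert (Hm : Rabs (IZR m) <= Rabs (IZR m + b) + Rabs b).
    { rewrite <- (Rabs_Ropp b); eapply Rle_trans; [|apply Rabs_triang].
      right; f_equal; ring. }
    assert (Hkm : d * (Rabs (IZR k) + Rabs (IZR m) - Rabs (a - b) - Rabs b)
      <= (IZR k + IZR m + a) ^ 2 - (IZR m + b) ^ 2).
    { eapply Rle_trans; [|exact Hle]; apply Rmult_le_compat_l; lra. }
    apply (Rmult_le_compat_l q) in Hkm; lra.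
Qed.

Lemma ex_sum_diagonal_term : ex_sum diagonal_term.
Proof.
  destruct diagonal_term_dominated as [K [r [Hr Hdom]]].
  eapply ex_sum_dominated; [exact Hdom|].
  apply (bounded_sums_scal (exp K) (fun p : Z * Z => _)); [left; apply exp_pos|].
  apply (bounded_sums_prod (fun k => exp (- r * Rabs (IZR k)))
           (fun k => exp (- r * Rabs (IZR k))));
    try (intros; left; apply exp_pos); apply bounded_sums_exp_abs, Hr.
Qed.

(** Existence comes first: the recurrence along a diagonal determines the sum only once it is known
    to converge. *)
Lemma ex_sum_diagonal_section (k : Z) : ex_sum (fun m => diagonal_term (k, m)).
Proof.
  destruct diagonal_term_dominated as [K [r [Hr Hdom]]].
  eapply ex_sum_dominated; [intros m; apply (Hdom (k, m))|]; simpl.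
  apply bounded_sums_scal; [left; apply exp_pos|].
  apply bounded_sums_scal; [left; apply exp_pos|].
  apply bounded_sums_exp_abs, Hr.
Qed.

(** |r_k| = exp(-6 pi (k v + y1 - y2)) equals 1 only if y1 - y2 = -k v, which [hy12] excludes. *)
Lemma ratio_neq_1 (k : Z) : (1 - ratio k <> 0)%C.
Proof.
  intros E.
  assert (E' : Cmod (ratio k) = 1).
  { replace (ratio k) with (1 - (1 - ratio k))%C by ring.
    rewrite E; replace (1 - 0)%C with (RtoC 1) by ring; apply Cmod_1. }
  unfold ratio in E'; rewrite Cmod_mult, !Cmod_epow, <- exp_plus in E'.
  apply (hy12 (- k)); rewrite opp_IZR.
  assert (E'' : -6 * PI * (IZR k * Im tau + (Im z1 - Im z2)) = 0).
  { apply exp_inv; rewrite exp_0; etransitivity; [|exact E'].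
    f_equal; unfold Im; simpl; ring. }
  pose proof PI_RGT_0; apply Rmult_integral in E'' as [?|?]; lra.
Qed.

(* With h m the terms on the k-th diagonal, h (m + 1) - ratio k * h m is
   supported at m + 1 = - N, so the sum s satisfies (1 - ratio k) s = edge term
   for both signs of k + a - b, without any geometric series. *)
Lemma is_sum_diagonal_section (k : Z) :
  is_sum (fun m => diagonal_term (k, m))
    (monomial z1 z2 tau (IZR k - IZR N) (- IZR N) / (1 - ratio k))%C.
Proof.
  destruct (ex_sum_diagonal_section k) as [s Hs].
  set (h := fun m => diagonal_term (k, m)) in Hs.
  set (g := fun m => (h (Z.succ m) + - ratio k * h m)%C).
  assert (Hstep : forall m, g m
    = ((chi3 (IZR k + IZR m + a + 1) (IZR m + b + 1)
        - chi3 (IZR k + IZR m + a) (IZR m + b))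
       * monomial z1 z2 tau (IZR k + IZR m + 1) (IZR m + 1))%C).
  { intros m; unfold g, h; rewrite !diagonal_termE, succ_IZR.
    replace (IZR k + (IZR m + 1)) with (IZR k + IZR m + 1) by ring.
    replace (IZR k + IZR m + 1 + a) with (IZR k + IZR m + a + 1) by ring.
    replace (IZR m + 1 + b) with (IZR m + b + 1) by ring.
    rewrite monomial_diagonal_step.
    replace (IZR k + IZR m - IZR m) with (IZR k) by ring.
    fold (ratio k); ring. }
  (* The shifted sequence has the same sum [s], since m -> m + 1 permutes the integers. *)
  assert (Hg : is_sum g (s + - ratio k * s)%C).
  { apply is_sum_plus; [|apply is_sum_scal, Hs].
    apply (is_sum_reindex Z.succ Z.pred h); auto using Z.pred_succ, Z.succ_pred. }
  assert (Hb : IZR N < b < IZR N + 1).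
  { pose proof (Zfloor_bound b) as [H1 H2]; pose proof (b_not_Z N).
    fold N in H1, H2; lra. }
  (* As N < b < N + 1, only m = -N - 1 satisfies m + b < 0 < m + 1 + b; at every other m the sign is
     constant across the step. *)
  assert (Hg' : is_sum g (g (- N - 1)%Z)).
  { apply is_sum_single; intros m Hm; rewrite Hstep.
    rewrite chi3_diagonal_const; [ring|].
    assert (Hm' : (- N <= m \/ m <= - N - 2)%Z) by lia.
    destruct Hm' as [Hm'|Hm']; apply IZR_le in Hm';
      rewrite ?minus_IZR, opp_IZR in Hm'; lra. }
  pose proof (is_sum_det g _ _ Hg Hg') as E; rewrite Hstep, <- RtoC_minus in E.
  rewrite minus_IZR, opp_IZR in E.
  rewrite chi3_diagonal_jump in E.
  (* The jump equals 1 only off the line x1 = x2, where chi_3 vanishes; here x1 - x2 = k + a - b is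
     nonzero. *)
  2: { intros E'; apply (a_minus_b_not_Z (- k)); rewrite opp_IZR; lra. }
  2: lra.
  replace (IZR k + (- IZR N - 1) + 1) with (IZR k - IZR N) in E by ring.
  replace (- IZR N - 1 + 1) with (- IZR N) in E by ring.
  rewrite Cmult_1_l in E; rewrite <- E.
  replace ((s + - ratio k * s) / (1 - ratio k))%C with s; [exact Hs|].
  field; apply ratio_neq_1.
Qed.

End Trapezoids.

(** * Identification with the Appell function *)

Theorem proposition6p2 (z1 z2 tau : C)
  (htau : 0 < Im tau)
  (hy2 : forall m : Z, Im z2 <> IZR m * Im tau)
  (hy12 : forall m : Z, Im z1 - Im z2 <> IZR m * Im tau) :
  let N : R := IZR (Zfloor (Im z2 / Im tau)) in
  let s : R := 3 * (1 / 2 + N) in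
  let w1 : C := (3 * (z1 - z2))%C in
  let w2 : C := (3 * z1 - 3 * N * tau - 3 * tau / 2 + 1 / 2)%C in
  ex_sum (f3_term z1 z2 tau)
  /\ appell_defined w1 w2 (3 * tau)%C
  /\ f3 z1 z2 tau
     = (epow z1 (- s) * epow z2 s * appell w1 w2 (3 * tau))%C.
Proof.
  intros N s w1 w2.
  set (c := (epow z1 (- s) * epow z2 s * Cexp (PI * Ci * w1))%C).
  assert (Hc : c <> 0%C) by (repeat apply Cmult_neq_0; apply Cexp_neq_0).
  destruct (ex_sum_diagonal_term z1 z2 tau htau hy2 hy12) as [S HS].
  (* Convergence of the Appell series is inherited from the double series: up to the constant [c],
     its terms are the diagonal sums. *)
  assert (HA : is_sum (appell_term w1 w2 (3 * tau)) (/ c * S)%C).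
  { apply is_sum_ext with (fun k => / c *
      (monomial z1 z2 tau (IZR k - N) (- N) / (1 - ratio z1 z2 tau k)))%C.
    - intros k; rewrite monomial_edge; fold s w1 w2 c.
      unfold appell_term.
      change (appell_denom w1 (3 * tau) k) with (1 - ratio z1 z2 tau k)%C.
      field; split; [apply ratio_neq_1 | exact Hc]; assumption.
    - apply is_sum_scal, (is_sum_sections (diagonal_term z1 z2 tau)); [exact HS|].
      intros k; apply is_sum_diagonal_section; assumption. }
  assert (HF : is_sum (f3_term z1 z2 tau) S).
  { apply is_sum_ext with (fun n : Z * Z =>
      diagonal_term z1 z2 tau (fst n - snd n, snd n)%Z).
    - intros [n1 n2]; unfold diagonal_term; simpl; do 2 f_equal; lia.
    - apply (is_sum_reindex (fun n : Z * Z => (fst n - snd n, snd n)%Z)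
        (fun p : Z * Z => (fst p + snd p, snd p)%Z)); [| | exact HS];
        intros [n1 n2]; simpl; f_equal; lia. }
  split; [exists S; exact HF|]; split; [split|].
  - intros k; apply ratio_neq_1; assumption.
  - eexists; exact HA.
  - unfold f3, appell; rewrite (is_sum_unique _ _ HF), (is_sum_unique _ _ HA).
    rewrite !Cmult_assoc; fold c; field; exact Hc.
Qed.
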